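(* Let $R$ be a unital $*$-ring and let $a,b\in R$ be core invertible such that $ab$ is Moore-Penrose invertible. Then: (i) $(ab)^{\dagger}=a^{(\#)}b^{(\#)}$ if and only if $abR\subseteq bR$ and $a^{(\#)}b=(ab)^{\dagger}b^2$; (ii) $(ab)^{\dagger}=a^{(\#)}b^{(\#)}$ if and only if $Rab\subseteq Ra^*$ and $a^*b^{(\#)}=a^*a(ab)^{\dagger}$.
   Context: A unital $*$-ring is an associative ring $R$ with unity $1$ equipped with an involution $*:R\to R$ satisfying $(a+b)^*=a^*+b^*$, $(ab)^*=b^*a^*$ and $(a^* )^*=a$ for all $a,b\in R$. An element $a\in R$ is core invertible if there exists $x\in R$ with $axa=a$, $xax=x$, $(ax)^*=ax$, $xa^2=a$ and $ax^2=x$; such an $x$ is unique when it exists, is called the core inverse of $a$, and is denoted $a^{(\#)}$. An element $a\in R$ is Moore-Penrose invertible if there exists $x\in R$ with $axa=a$, $xax=x$, $(ax)^*=ax$ and $(xa)^*=xa$; such an $x$ is unique when it exists and is denoted $a^{\dagger}$. For $c\in R$, $cR=\{cr:r\in R\}$ and $Rc=\{rc:r\in R\}$. *)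

(* Defs.v *)
From HB Require Import structures.
From mathcomp Require Import all_boot ssralg classical_sets.

Set Implicit Arguments.
Unset Strict Implicit.
Unset Printing Implicit Defensive.

Import GRing.Theory.
Local Open Scope ring_scope.

(* The base is pzRingType rather than nzRingType: nothing excludes 1 = 0. *)
HB.mixin Record PzRing_hasStar R of GRing.PzRing R := {
  star : R -> R;
  starD : forall a b, star (a + b) = star a + star b;
  starM : forall a b, star (a * b) = star b * star a;
  starK : forall a, star (star a) = a
}.

#[short(type="starRingType")]
HB.structure Definition StarRing := { R of PzRing_hasStar R & GRing.PzRing R }.

Section StarRingInverses.
Variable R : starRingType.
Implicit Types a x y c : R.

Definition is_core_inverse a x : Prop :=
  [/\ a * x * a = a,
      x * a * x = x,
      star (a * x) = a * x,
      x * a ^+ 2 = a &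
      a * x ^+ 2 = x].

Definition is_mp_inverse a x : Prop :=
  [/\ a * x * a = a,
      x * a * x = x,
      star (a * x) = a * x &
      star (x * a) = x * a].

Definition right_principal c : set R := [set c * r | r in setT]%classic.
Definition left_principal c : set R := [set r * c | r in setT]%classic.

(* Uniqueness of both inverses: quantifying over an x that is the core (resp.
   Moore-Penrose) inverse of a is the same as assuming a invertible in that
   sense and speaking of its inverse. *)
Lemma inner_left_proj_eq a x y :
  a * x * a = a -> star (a * x) = a * x ->
  a * y * a = a -> star (a * y) = a * y -> a * x = a * y.
Proof.
move=> ax sx ay sy.
by rewrite -sx -{1}ay -mulrA starM sx sy mulrA ax.
Qed.

Lemma core_inverse_uniq a x y :
  is_core_inverse a x -> is_core_inverse a y -> x = y.
Proof.
move=> [ax1 ax2 ax3 ax4 ax5] [ay1 ay2 ay3 ay4 ay5].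
have e : a * x = a * y by exact: inner_left_proj_eq.
by rewrite -ax2 -mulrA e -{1}ay5 2!mulrA -(mulrA x) -expr2 ax4.
Qed.

Lemma mp_inverse_uniq a x y :
  is_mp_inverse a x -> is_mp_inverse a y -> x = y.
Proof.
move=> [ax1 ax2 ax3 ax4] [ay1 ay2 ay3 ay4].
have e : a * x = a * y by exact: inner_left_proj_eq.
have f : x * a = y * a.
  by rewrite -ax4 -{1}ay1 -(mulrA a) mulrA starM ay4 ax4 -mulrA (mulrA a) ax1.
by rewrite -ax2 f -mulrA e mulrA.
Qed.

End StarRingInverses.

(* Main.v *)
Require Import Defs.
From HB Require Import structures.
From mathcomp Require Import all_boot ssralg classical_sets.

Set Implicit Arguments.
Unset Strict Implicit.
Unset Printing Implicit Defensive.

Import GRing.Theory.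
Local Open Scope classical_set_scope.
Local Open Scope ring_scope.

(** Write [x], [y] for the core inverses of [a], [b] and [m] for the
    Moore-Penrose inverse of [c = a * b].  The elements [a * x] and [b * y] are
    self-adjoint idempotents (projections) with [R a^* = R (a * x)] and
    [b R = (b * y) R].  So the two inclusions say that a projection fixes [c]
    on one side: [b * y * c = c], respectively [c * (a * x) = c].

    Since [m] lies in [R c^*] and in [c^* R], and [c] in [m^* R] and in
    [R m^*], a self-adjoint [p] satisfies [p * c = c] exactly when
    [m * p = m], and [c * p = c] exactly when [p * m = m]
    ([mp_inverse_fix_left], [mp_inverse_fix_right]).  So the inclusions become
    [m * (b * y) = m] and [a * x * m = m].  Both hold when [m = x * y], because
    [y * b * y = y] and [a * x ^+ 2 = x].  Conversely, [x * b = m * b ^+ 2]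
    multiplied on the right by [y ^+ 2] reads [x * y = m * (b * y)], and
    [a^* * y = a^* * a * m] multiplied on the left by [x * x^*] reads
    [x * y = x * a * m], which equals [m] as soon as [a * x * m = m]. *)

Section Principal.
Variable R : starRingType.
Implicit Types c d z : R.

Lemma right_principal_subP c d z : d * z * d = d ->
  right_principal c `<=` right_principal d <-> d * z * c = c.
Proof.
move=> dzd; split=> [sub|dzc].
  have [|r _ <-] := sub c; first by exists 1; rewrite ?mulr1.
  by rewrite mulrA dzd.
by move=> _ [r _ <-]; exists (z * c * r); rewrite // !mulrA dzc.
Qed.

Lemma left_principal_subP c d z : d * z * d = d ->
  left_principal c `<=` left_principal d <-> c * (z * d) = c.
Proof.
move=> dzd; split=> [sub|czd].
  have [|r _ <-] := sub c; first by exists 1; rewrite ?mul1r.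
  by rewrite -mulrA (mulrA d) dzd.
by move=> _ [r _ <-]; exists (r * c * z); rewrite // -!mulrA czd.
Qed.

End Principal.

Section MoorePenrose.
Variable R : starRingType.
Implicit Types c m p : R.

Lemma mp_inverse_sym c m : is_mp_inverse c m -> is_mp_inverse m c.
Proof. by case=> cmc mcm scm smc; split. Qed.

(** [m = m * (c * m)^* = m * m^* * c^*] and [c = (c * m)^* * c = m^* * c^* * c],
    and [p * c = c] is adjoint to [c^* * p = c^*], [m * p = m] to
    [p * m^* = m^*]. *)
Lemma mp_inverse_fix_left c m p : is_mp_inverse c m -> star p = p ->
  p * c = c <-> m * p = m.
Proof.
move=> [cmc mcm scm _] sp; split=> [pc|mp].
  by rewrite -mcm -(mulrA m) -scm starM -!mulrA -{1}sp -(starM p c) pc.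
by rewrite -cmc -scm starM !mulrA -{1}sp -(starM m p) mp.
Qed.

Lemma mp_inverse_fix_right c m p : is_mp_inverse c m -> star p = p ->
  c * p = c <-> p * m = m.
Proof.
by move=> /mp_inverse_sym mc sp; have [] := mp_inverse_fix_left mc sp; split.
Qed.

End MoorePenrose.

Theorem theorem3p9 (R : starRingType) (a b a_core b_core ab_mp : R)
    (ha : is_core_inverse a a_core)
    (hb : is_core_inverse b b_core)
    (hab : is_mp_inverse (a * b) ab_mp) :
  (ab_mp = a_core * b_core <->
     right_principal (a * b) `<=` right_principal b /\
     a_core * b = ab_mp * b ^+ 2) /\
  (ab_mp = a_core * b_core <->
     left_principal (a * b) `<=` left_principal (star a) /\
     star a * b_core = star a * a * ab_mp).
Proof.
move: a_core b_core ab_mp ha hb hab => x y m [axa xax sax xa2 ax2].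
move=> [byb yby sby yb2 by2] hab.
have sx_a : star x * star a = a * x by rewrite -starM.
have sa_ax : star a * (a * x) = star a by rewrite -sax -starM axa.
have sasxsa : star a * star x * star a = star a by rewrite -mulrA sx_a.
split.
  rewrite (right_principal_subP (a * b) byb) (mp_inverse_fix_left hab sby).
  split=> [->|[mby xb]]; first by rewrite -!mulrA (mulrA y) yby yb2.
  by rewrite -mby -by2 !mulrA xb expr2 -!mulrA -expr2 by2.
rewrite (left_principal_subP (a * b) sasxsa) sx_a.
rewrite (mp_inverse_fix_right hab sax).
split=> [->|[axm ay]].
  by rewrite mulrA -(mulrA a) -expr2 ax2 -mulrA (mulrA a) mulrA sa_ax.
have xy : x * y = x * a * m.
  by rewrite -{1}xax -(mulrA x) -sx_a -!mulrA ay !mulrA -(mulrA x) sx_a mulrA xax.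
(* [x * a] fixes the range of [a], which contains [m]. *)
by rewrite xy -{2}axm !mulrA -(mulrA x) -expr2 xa2 axm.
Qed.
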